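(* Let $(X,d,\mu)$ be a complete metric measure space, where $\mu$ is a doubling measure, and let $\{(X_\alpha,\mathbf{x}_\alpha)\}_{\alpha\in\Lambda}$ be an approximate differentiable structure on $(X,d,\mu)$. Suppose that $E\subset X$ and $f:E\to\mathbb{R}$ is a $\mu$-measurable function. Then the following conditions are equivalent: (a) $f$ is approximately differentiable $\mu$-a.e. in $E$ (with respect to $\{(X_\alpha,\mathbf{x}_\alpha)\}_{\alpha\in\Lambda}$). (b) For any $\varepsilon>0$ there is a closed set $F\subset E$ such that $\mu(E\setminus F)<\varepsilon$ and $f|_F$ is locally Lipschitz. (c) $f$ induces a Luzin decomposition of $E$, that is, $$E=\bigcup_{j=1}^{\infty}E_j\cup Z,$$ where the $E_j$ are measurable sets, each $f|_{E_j}$ is a Lipschitz function, and $Z$ has measure zero.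
   Context: A metric measure space $(X,d,\mu)$ is a separable metric space $(X,d)$ with a non-trivial, locally finite Borel regular measure $\mu$. $B(x,r)=\{y\in X: d(x,y)<r\}$. The measure $\mu$ is doubling if there is $C_\mu>0$ with $\mu(B(x,2r))\le C_\mu\,\mu(B(x,r))$ for all $x\in X$, $r>0$. A point $x$ is a density point of a $\mu$-measurable set $A$ if $\lim_{r\to0}\mu(B(x,r)\cap A)/\mu(B(x,r))=1$. We write $\operatorname{ap\,lim}_{y\to x}F(y)=l$ if for every $\varepsilon>0$ the point $x$ is a density point of $\{y:|F(y)-l|<\varepsilon\}$. An approximate differentiable structure on $(X,d,\mu)$ is a countable collection $\{(X_\alpha,\mathbf{x}_\alpha)\}_{\alpha\in\Lambda}$ of measurable sets $X_\alpha\subset X$ and Lipschitz maps $\mathbf{x}_\alpha=(x_\alpha^1,\dots,x_\alpha^{N(\alpha)}):X\to\mathbb{R}^{N(\alpha)}$ such that: (i) $\mu(X\setminus\bigcup_\alpha X_\alpha)=0$; (ii) there is $N\ge0$ with $N(\alpha)\le N$ for all $\alpha$; (iii) for every Lipschitz $f:X\to\mathbb{R}$ and every $\alpha$ there is a unique (up to a set of measure zero) measurable bounded function $d^\alpha f:X_\alpha\to\mathbb{R}^{N(\alpha)}$ such that for $\mu$-a.e. $x\in X_\alpha$ $$\operatorname{ap\,lim}_{y\to x}\frac{|f(y)-f(x)-d^\alpha f(x)\cdot(\mathbf{x}_\alpha(y)-\mathbf{x}_\alpha(x))|}{d(x,y)}=0.$$ A function $f$ is approximately differentiable at $x\in X_\alpha$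 with respect to $(X_\alpha,\mathbf{x}_\alpha)$ if there is a vector $L^\alpha f(x)\in\mathbb{R}^{N(\alpha)}$ such that $$\operatorname{ap\,lim}_{y\to x}\frac{|f(y)-f(x)-L^\alpha f(x)\cdot(\mathbf{x}_\alpha(y)-\mathbf{x}_\alpha(x))|}{d(x,y)}=0,$$ i.e. for every $\varepsilon>0$ the set of $y$ for which the quotient is less than $\varepsilon$ has $x$ as a density point. For $f$ defined only on $E\subset X$, the points $y$ in this set are taken in $E$. *)

(* Defs.v *)
From HB Require Import structures.
From mathcomp Require Import all_boot all_order all_algebra.
From mathcomp Require Import all_classical all_reals all_analysis.

Set Implicit Arguments.
Unset Strict Implicit.
Unset Printing Implicit Defensive.

Import Order.TTheory GRing.Theory Num.Theory.
Import numFieldNormedType.Exports.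

Local Open Scope classical_set_scope.
Local Open Scope ring_scope.

#[short(type="completeMetricType")]
HB.structure Definition CompleteMetric (K : numDomainType) :=
  { M of Metric K M & Complete M }.

(** "Measure" is meant in the sense of geometric measure theory: a Borel
    regular measure is an outer measure defined on all subsets of [X], its
    measurable sets are the Caratheodory ones ([mu.-caratheodory]), and a null
    set is a set [A] with [mu A = 0]. *)
Section metric_measure_space.
Context {R : realType} {X : metricType R}.
Implicit Types (mu : {outer_measure set X -> \bar R}) (A D E : set X).

Definition borel_regular mu :=
  (forall B, <<s open >> B -> mu.-caratheodory B) /\
  (forall A, exists B, [/\ <<s open >> B, A `<=` B & mu B = mu A]).

Record metric_measure_space mu : Prop := {
  mms_separable : exists2 D : set X, countable D & dense D ;
  mms_nontrivial : (0 < mu setT)%E ;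
  mms_locally_finite : forall x, exists2 r, 0 < r & (mu (ball x r) < +oo)%E ;
  mms_borel_regular : borel_regular mu }.

Definition doubling mu := exists2 C : R, 0 < C &
  forall x r, 0 < r -> (mu (ball x (2 * r)) <= C%:E * mu (ball x r))%E.

Definition ae_in mu A (P : X -> Prop) := mu (A `&` [set x | ~ P x]) = 0%E.

(** A function of domain [A] is represented by a total function whose values
    outside [A] are irrelevant. Taking [U := setT] shows that the domain of a
    measurable function is measurable. *)
Definition mu_measurable_fun {V : topologicalType} mu A (g : X -> V) :=
  forall U : set V, open U -> mu.-caratheodory (A `&` g @^-1` U).

(** On ['rV_n] the library norm is the sup norm, which is equivalent to the
    Euclidean one. *)
Definition lipschitz_within {V : normedModType R} A (g : X -> V) :=
  exists K : R, forall x y, A x -> A y -> `|g x - g y| <= K * mdist x y.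

Definition locally_lipschitz_within {V : normedModType R} A (g : X -> V) :=
  forall x, A x -> exists2 U, nbhs x U & lipschitz_within (A `&` U) g.

Definition density_point mu A (x : X) :=
  mu.-caratheodory A /\
  (mu (ball x r `&` A) / mu (ball x r))%E @[r --> 0^'+] --> 1%E.

(** [ap lim_(y -> x) F y = l], where [F] has domain [D]. *)
Definition ap_lim mu D (F : X -> R) (x : X) (l : R) :=
  forall e, 0 < e -> density_point mu [set y | D y /\ `|F y - l| < e] x.

(** The quotient below is [0 / 0 = 0] at [y = x], so that the point [x] never
    obstructs the approximate limit; this only matters if [{x}] has positive
    measure, i.e. in a doubling space, if [x] is isolated. *)
Definition approx_derivative mu D (g : X -> R) n (phi : X -> 'rV[R]_n)
    (x : X) (L : 'rV[R]_n) :=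
  ap_lim mu D (fun y =>
    `|g y - g x - \sum_(i < n) L 0 i * (phi y - phi x) 0 i| / mdist x y) x 0.

Definition approx_differentiable mu D (g : X -> R) n (phi : X -> 'rV[R]_n)
    (x : X) := exists L, approx_derivative mu D g phi x L.

(** [df] is an admissible [d^alpha g] on the chart [(A, phi)]. *)
Definition is_differential mu A n (phi : X -> 'rV[R]_n) (g : X -> R)
    (df : X -> 'rV[R]_n) :=
  [/\ mu_measurable_fun mu A df,
      exists M : R, forall x, A x -> `|df x| <= M &
      ae_in mu A (fun x => approx_derivative mu setT g phi x (df x))].

Record approx_diff_structure mu (I : countType) (Xa : I -> set X)
    (N : I -> nat) (xa : forall a, X -> 'rV[R]_(N a)) : Prop := {
  ads_measurable : forall a, mu.-caratheodory (Xa a) ;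
  ads_lipschitz : forall a, lipschitz_within setT (xa a) ;
  ads_cover : mu (~` \bigcup_a Xa a) = 0%E ;
  ads_dim_bounded : exists N0, forall a, (N a <= N0)%N ;
  ads_differential : forall (g : X -> R) a, lipschitz_within setT g ->
    exists2 df, is_differential mu (Xa a) (xa a) g df &
      forall df', is_differential mu (Xa a) (xa a) g df' ->
        ae_in mu (Xa a) (fun x => df' x = df x) }.

Definition approx_differentiable_ae mu (I : countType) (Xa : I -> set X)
    (N : I -> nat) (xa : forall a, X -> 'rV[R]_(N a)) E (f : X -> R) :=
  ae_in mu E (fun x =>
    forall a, Xa a x -> approx_differentiable mu E f (xa a) x).

Definition luzin_decomposition mu E (f : X -> R) :=
  exists (Ej : nat -> set X) (Z : set X),
    [/\ E = \bigcup_j Ej j `|` Z,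
        forall j, mu.-caratheodory (Ej j),
        forall j, lipschitz_within (Ej j) f &
        mu Z = 0%E].

End metric_measure_space.

(* Main.v *)
Require Import Defs.
From HB Require Import structures.
From mathcomp Require Import all_boot all_order all_algebra.
From mathcomp Require Import all_classical all_reals all_analysis.
From mathcomp Require Import lra.
Import Order.TTheory GRing.Theory Num.Theory.
Import numFieldNormedType.Exports.
Local Open Scope classical_set_scope.
Local Open Scope ring_scope.

(** The condition that links the three properties is that almost all of [E] is
    covered by countably many sets on which [f] is Lipschitz
    ([lipschitz_coverable]).

    If [f] is approximately differentiable at [x], the graph of [f] stays in a
    cone [`|f y - f x| <= M * mdist x y] for [y] in a set with density [1] at
    [x]. Fixing the slope and the scale at which the density becomes close to
    [1] splits almost all of [E] into countably many sets. On each of them the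
    cones of two nearby points have a common point, by doubling, and this makes
    [f] Lipschitz at small scales ([cone_points_lipschitz]); separability then
    yields countably many pieces. They become measurable when each is replaced
    by the set where [f] agrees with a McShane extension of its restriction
    ([mcshane], [luzin_decomposition_coverable]).

    Given a Luzin decomposition, inner regularity ([caratheodory_inner_regular])
    replaces the pieces by closed sets. After removing a set of small measure
    these are disjoint and locally finite, so that their union is closed and
    [f] is locally Lipschitz on it ([closed_of_luzin]). Conversely, closed sets
    that exhaust almost all of [E] and carry a locally Lipschitz restriction of
    [f] decompose by separability ([coverable_of_closed]).

    Finally, a Luzin decomposition gives approximate differentiability: the
    Lipschitz extensions from the pieces are approximately differentiable
    almost everywhere on each chart by definition of the structure, and by the
    Lebesgue density theorem ([ae_density_point]) almost every point of a piece
    is one of its density points, where [f] inherits the derivative of the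
    extension. The density theorem itself rests on outer regularity and on a
    Vitali covering argument: a countable subcover is cut to a finite one at a
    small cost, so that the greedy finite form of the covering lemma
    ([finite_vitali]) suffices. *)

Set Implicit Arguments.
Unset Strict Implicit.
Unset Printing Implicit Defensive.

(** * Outer measures *)

Section outer_measure_facts.
Context {T : Type} {R : realType} (mu : {outer_measure set T -> \bar R}).
Implicit Types (A X : set T).
Local Open Scope ereal_scope.

(** Continuity from above, obtained as the vanishing tail of the convergent
    series of the measures of the disjointed pieces; localizing to [X] is what
    makes that series finite when [mu] is only locally finite. *)
Lemma caratheodory_tail (A : (set T)^nat) X :
    (forall n, mu.-caratheodory (A n)) -> mu (X `&` \bigcup_k A k) < +oo ->
  forall e : R, (0 < e)%R -> exists N,
    mu (X `&` (\bigcup_k A k `\` \bigcup_(k < N) A k)) < e%:E.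
Proof.
move=> mA muoo e e0.
have mB n : mu.-caratheodory (seqDU A n).
  by apply: caratheodory_measurable_setD => //;
    exact: caratheodory_measurable_bigsetU.
have /= le_mu := caratheodory_lime_le mB (trivIset_seqDU A)
  (X `&` \bigcup_k A k).
have sum_fin : \sum_(0 <= k <oo) mu (X `&` \bigcup_k A k `&` seqDU A k) < +oo.
  apply: le_lt_trans muoo; apply: le_trans le_mu.
  by rewrite -seqDU_bigcup_eq leeDl ?outer_measure_ge0.
have tail0 : \forall N \near \oo,
    \sum_(N <= k <oo) mu (X `&` \bigcup_k A k `&` seqDU A k) < e%:E.
  have /(_ (fun _ _ => outer_measure_ge0 _ _)) cvg0 :=
    nneseries_tail_cvg sum_fin.
  apply: (cvg0 [set y | y < e%:E]); apply: open_nbhs_nbhs.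
  by split; [exact: open_ereal_lt_ereal|rewrite /= lte_fin].
have [N _ /(_ N (leqnn N))/= tailN] := tail0.
exists N; apply: le_lt_trans tailN.
apply: le_trans (outer_measure_sigma_subadditive_tail _ _ _).
apply: le_outer_measure => x [Xx [Ax nAx]].
have := Ax; rewrite seqDU_bigcup_eq => -[n _ Bnx].
exists n => /=; last by rewrite -seqDU_bigcup_eq.
by move=> nN; apply: nAx; exists n => //; exact: (subset_seqDU Bnx).
Qed.

Lemma bigcup_null (A : (set T)^nat) :
  (forall n, mu (A n) = 0) -> mu (\bigcup_n A n) = 0.
Proof.
move=> A0; apply/eqP; rewrite eq_le outer_measure_ge0 andbT.
apply: le_trans (outer_measure_sigma_subadditive _ _) _.
by rewrite eseries0// => n _ _; exact: A0.
Qed.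

Lemma bigcup_le_eps (A : (set T)^nat) (e : R) : (0 <= e)%R ->
  (forall n, mu (A n) <= (e / (2 ^ n.+1)%:R)%:E) -> mu (\bigcup_n A n) <= e%:E.
Proof.
move=> e0 Ae; apply: le_trans (epsilon_trick0 xpredT e0).
apply: le_trans (outer_measure_sigma_subadditive _ _) _.
by apply: lee_nneseries => n _; [rewrite outer_measure_ge0|exact: Ae].
Qed.

Lemma bigcup_seq_le (I : eqType) (D : seq I) (A : I -> set T) :
  mu (\bigcup_(i in [set` D]) A i) <= \sum_(i <- D) mu (A i).
Proof.
elim: D => [|i D IH].
  rewrite big_nil (_ : bigcup _ _ = set0) ?outer_measure0//.
  by apply/seteqP; split => // x [].
rewrite big_cons; apply: le_trans (leeD2l _ IH).
apply: le_trans (outer_measureU2 _ _ _); apply: le_outer_measure => x [j /=].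
by rewrite inE => /predU1P[->|jD] Ajx; [left|right; exists j].
Qed.

Lemma null_subset A X : A `<=` X -> mu X = 0 -> mu A = 0.
Proof.
move=> AX X0; apply/eqP; rewrite eq_le outer_measure_ge0 andbT -X0.
exact: le_outer_measure.
Qed.

(** Splitting [X] along one [B i] at a time gives the bound for an arbitrary
    [X], measurable or not. *)
Lemma sum_caratheodory_le (I : eqType) (D : seq I) (B : I -> set T) X :
    (forall i, mu.-caratheodory (B i)) -> uniq D -> trivIset [set` D] B ->
  \sum_(i <- D) mu (X `&` B i) <= mu X.
Proof.
move=> mB; elim: D X => [|i D IH] X /=; first by rewrite big_nil outer_measure_ge0.
move=> /andP[iD uD] tD; rewrite big_cons (mB i X); apply: leeD2l.
apply: le_trans (IH (X `&` ~` B i) uD _); last first.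
  by apply: sub_trivIset tD => j /= jD; rewrite inE jD orbT.
rewrite big_seq [leRHS]big_seq; apply: lee_sum => j jD.
apply: le_outer_measure => x [Xx Bjx]; split => //; split => // Bix.
have ij : i = j.
  by apply: tD; rewrite /= ?inE ?eqxx ?jD ?orbT//; exists x.
by move: iD; rewrite ij jD.
Qed.

End outer_measure_facts.

(** * Metric spaces: countable subcovers and finite Vitali covering *)

Section metric_facts.
Context {R : realType} {X : metricType R}.
Implicit Types (x y : X) (A P S : set X) (r : R).

Lemma in_ballE x r y : ball x r y = (mdist x y < r) :> Prop.
Proof. by rewrite ballEmdist. Qed.

Lemma inv_succ_lt r : 0 < r -> exists n, n.+1%:R^-1 < r.
Proof.
move=> r0; have [n _ /(_ n (leqnn n))] := near_infty_natSinv_lt (PosNum r0).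
by exists n.
Qed.

Lemma open_ball_mdist x r : open (ball x r).
Proof.
rewrite openE => y; rewrite in_ballE => xy; rewrite /interior.
apply/nbhs_ballP; exists (r - mdist x y) => /=; first by rewrite subr_gt0.
move=> z; rewrite !in_ballE => yz.
by have := metric_triangle x y z; lra.
Qed.

(** The Lindelof property. The balls of radius [1 / n.+1] centred in a dense
    countable set form a countable base; for each of them that fits in some
    [U x] with [x] in it, one such [x] is retained. *)
Lemma separable_countable_subcover P (U : X -> set X) :
    (exists2 D : set X, countable D & dense D) -> P !=set0 ->
    (forall x, P x -> nbhs x (U x)) ->
  exists2 c : nat -> X, (forall n, P (c n)) & P `<=` \bigcup_n U (c n).
Proof.
move=> [D cD dD] [x0 Px0] PU.
pose good (p : X * nat) := [set x | P x /\ ball p.1 p.2.+1%:R^-1 x /\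
  ball p.1 p.2.+1%:R^-1 `<=` U x].
(* [x0] is the value at the basic balls that retain no point. *)
pose h p := if pselect (good p !=set0) is left e then sval (cid e) else x0.
have Ph p : P (h p).
  by rewrite /h; case: pselect => // e; case: (cid e) => /= x [].
have : countable (D `*` [set: nat]).
  by apply: countableX => //; exact: countableP.
have [d [_ Dd]] : setT `&` D !=set0.
  by apply: dD; [exists x0|exact: openT].
move=> /pfcard_geP[/seteqP[/(_ (d, 0%N))]|[e]]; first by move/(_ (conj Dd I)).
exists (h \o e) => [n|x Px]; first exact: Ph.
have /nbhs_ballP[r /= r0 xr] := PU x Px.
have [n nr] : exists n, n.+1%:R^-1 < r / 2.
  by apply: inv_succ_lt; rewrite divr_gt0.
have n0 : 0 < n.+1%:R^-1 :> R by rewrite invr_gt0.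
have [d' []] : ball x n.+1%:R^-1 `&` D !=set0.
  by apply: dD; [exists x; exact: ballxx|exact: open_ball_mdist].
rewrite in_ballE => xd' Dd'.
have [k _ ek] : (e @` setT) (d', n) by apply: surj; split.
have gx : good (d', n) x.
  split=> //; split => /=; first by rewrite in_ballE metric_sym.
  move=> z; rewrite in_ballE => d'z; apply: xr; rewrite in_ballE.
  move: (metric_triangle x d' z) nr xd' d'z; move: (n.+1%:R^-1) => q; lra.
exists k => //=; rewrite ek /h; case: pselect => [g|[]]; last by exists x.
by case: (cid g) => /= y [_ [_ yU]]; apply: yU; case: gx => _ [].
Qed.

(** The [n]-th closed set consists of the points at distance at least
    [1 / n.+1] from the complement of [S]. *)
Lemma open_bigcup_closed S : open S ->
  exists2 K : (set X)^nat, (forall n, closed (K n)) & \bigcup_n K n = S.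
Proof.
move=> oS; exists (fun n => ~` \bigcup_(y in ~` S) ball y n.+1%:R^-1).
  move=> n; rewrite closedC; apply: bigcup_open => y _.
  exact: open_ball_mdist.
apply/seteqP; split => x => [[n _ Kx]|Sx].
  apply: contrapT => nSx; apply: Kx; exists x => //.
  by apply: ballxx; rewrite invr_gt0.
have /nbhs_ballP[r /= r0 xr] : nbhs x S by apply: open_nbhs_nbhs.
have [n nr] := inv_succ_lt r0.
exists n => // -[y nSy]; rewrite in_ballE metric_sym => xy.
by apply: nSy; apply: xr; rewrite in_ballE (lt_trans xy).
Qed.

(** The balls are chosen greedily by decreasing radius: a ball that is left
    out meets a chosen ball of at least the same radius. *)
Lemma finite_vitali (I : eqType) (c : I -> X) (r : I -> R) (s : seq I) :
    (forall i, 0 < r i) ->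
  exists D : seq I, [/\ uniq D, {subset D <= s},
    trivIset [set` D] (fun i => ball (c i) (r i)) &
    forall i, i \in s -> exists2 j, j \in D &
      ball (c i) (r i) `<=` ball (c j) (3 * r j)].
Proof.
move=> r0; pose LE i j := r i <= r j.
have LE_trans : transitive LE by move=> j i k ij jk; exact: le_trans ij jk.
have sub3 i : ball (c i) (r i) `<=` ball (c i) (3 * r i).
  by apply: le_ball; have := r0 i; lra.
wlog : s / sorted LE s.
  move=> wl; have /wl[D [uD Ds tD sD]] : sorted LE (sort LE s).
    by apply: sort_sorted => i j; exact: le_total.
  exists D; split => // [i /Ds|i si]; first by rewrite mem_sort.
  by apply: sD; rewrite mem_sort.
elim: s => [_|i s IH is_sorted]; first by exists [::]; split => // i j.
have [D [uD Ds tD sD]] := IH (path_sorted is_sorted).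
have r_le j : j \in s -> r i <= r j.
  by have /allP := order_path_min LE_trans is_sorted; apply.
have [[k [kD [z [iz kz]]]]|disj] := pselect (exists k, k \in D /\
    ball (c i) (r i) `&` ball (c k) (r k) !=set0).
  exists D; split => // [j /Ds js|j]; first by rewrite inE js orbT.
  rewrite inE => /predU1P[->|/sD//]; exists k => // y.
  move: iz kz; rewrite !in_ballE => iz kz iy.
  have := metric_triangle (c k) z y; have := metric_triangle z (c i) y.
  by rewrite (metric_sym z (c i)); have := r_le k (Ds k kD); lra.
exists (i :: D); split => /=.
- rewrite uD andbT; apply/negP => iD; apply: disj; exists i; split => //.
  by exists (c i); split; exact: ballxx.
- move=> j; rewrite !inE => /predU1P[->|/Ds ->]; first by rewrite eqxx.
  by rewrite orbT.
- move=> j k /=; rewrite !inE => /predU1P[->|jD] /predU1P[->|kD] //.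
  + by move=> ik; case: disj; exists k.
  + by rewrite setIC => ij; case: disj; exists j.
  + exact: tD.
- move=> j; rewrite inE => /predU1P[->|/sD[k kD jk]].
    by exists i; rewrite ?inE ?eqxx.
  by exists k; rewrite // inE kD orbT.
Qed.

End metric_facts.

(** * Lipschitz functions and measurability of their comparison sets *)

Lemma bigcup_unpickle (I : countType) (T : Type) (F : I -> set T) :
  \bigcup_i F i = \bigcup_n oapp F set0 (unpickle n).
Proof.
apply/seteqP; split => x [i _ Fix].
  by exists (pickle i) => //; rewrite pickleK.
by move: Fix; case: unpickle => //= j Fjx; exists j.
Qed.

Section lipschitz_facts.
Context {R : realType} {X : metricType R}.
Implicit Types (x y : X) (A B : set X).

Lemma lipschitz_withinS {V : normedModType R} A B (g : X -> V) :
  A `<=` B -> lipschitz_within B g -> lipschitz_within A g.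
Proof. by move=> AB [K gK]; exists K => x y /AB Bx /AB By; exact: gK. Qed.

Lemma eq_lipschitz_within {V : normedModType R} A (f g : X -> V) :
  (forall x, A x -> f x = g x) -> lipschitz_within A f -> lipschitz_within A g.
Proof.
by move=> fg [K fK]; exists K => x y Ax Ay; rewrite -!fg//; exact: fK.
Qed.

Lemma lipschitz_withinP {V : normedModType R} A (g : X -> V) :
  lipschitz_within A g -> exists2 K, 0 < K &
    forall x y, A x -> A y -> `|g x - g y| <= K * mdist x y.
Proof.
move=> [K gK]; exists (`|K| + 1) => [|x y Ax Ay]; first exact: ltr_wpDl.
apply: le_trans (gK x y Ax Ay) _; apply: ler_wpM2r; first exact: mdist_ge0.
by rewrite (le_trans (ler_norm K))// lerDl.
Qed.

(** The infimal convolution [x |-> inf_(a in A) (f a + K d(x, a))] is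
    McShane's extension. *)
Lemma mcshane A (f : X -> R) : lipschitz_within A f ->
  exists2 g : X -> R, lipschitz_within setT g & forall x, A x -> g x = f x.
Proof.
move=> /lipschitz_withinP[K K0 fK].
have [->|/set0P[a0 Aa0]] := eqVneq A set0.
  by exists (fun=> 0) => //; exists 0 => x y _ _; rewrite subrr normr0 mul0r.
pose S x := [set f a + K * mdist x a | a in A].
have S0 x : S x !=set0 by exists (f a0 + K * mdist x a0), a0.
have lbS x a : A a -> lbound (S x) (f a - K * mdist x a).
  move=> Aa _ [b Ab <-]; have := fK a b Aa Ab; rewrite ler_norml => /andP[_ ab].
  have : K * mdist a b <= K * (mdist x a + mdist x b).
    by rewrite ler_pM2l// (metric_sym x a) metric_triangle.
  lra.
pose g x := inf (S x).
have g_le x a : A a -> g x <= f a + K * mdist x a.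
  by move=> Aa; apply: ge_inf; [exists (f a0 - K * mdist x a0); exact: lbS
                               |exists a].
exists g => [|x Ax].
  have half x y : g x - g y <= K * mdist x y.
    rewrite lerBlDr -lerBlDl; apply: lb_le_inf => // _ [a Aa <-].
    have := g_le x a Aa.
    have : K * mdist x a <= K * (mdist x y + mdist y a).
      by rewrite ler_pM2l// metric_triangle.
    lra.
  exists K => x y _ _; rewrite ler_norml half andbT.
  by have := half y x; rewrite metric_sym; lra.
apply/eqP; rewrite eq_le; apply/andP; split.
  by have := g_le x x Ax; rewrite mdistxx mulr0 addr0.
by apply: lb_le_inf => //; have := lbS x x Ax; rewrite mdistxx mulr0 subr0.
Qed.

Lemma lipschitz_open_lt (q : X -> R) s :
  lipschitz_within setT q -> open [set x | q x < s].
Proof.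
move=> /lipschitz_withinP[K K0 qK]; rewrite openE => x /= qxs.
apply/nbhs_ballP; exists ((s - q x) / K) => /=.
  by rewrite divr_gt0// subr_gt0.
move=> y; rewrite in_ballE ltr_pdivlMr// mulrC => xy /=.
by have := qK x y Logic.I Logic.I; rewrite ler_norml => /andP[]; lra.
Qed.

Lemma lipschitzN (q : X -> R) A :
  lipschitz_within A q -> lipschitz_within A (fun x => - q x).
Proof.
move=> [K qK]; exists K => x y Ax Ay.
by rewrite -opprD normrN; exact: qK.
Qed.

Lemma lipschitz_open_gt (q : X -> R) s :
  lipschitz_within setT q -> open [set x | s < q x].
Proof.
move=> /lipschitzN/lipschitz_open_lt - /(_ (- s)).
by under eq_set do rewrite ltrN2.
Qed.

Lemma lipschitzD (q q' : X -> R) A : lipschitz_within A q ->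
  lipschitz_within A q' -> lipschitz_within A (fun x => q x + q' x).
Proof.
move=> [K qK] [K' qK']; exists (K + K') => x y Ax Ay.
rewrite opprD addrACA mulrDl (le_trans (ler_normD _ _))//.
by apply: lerD; [exact: qK|exact: qK'].
Qed.

Lemma lipschitz_mdist e x : lipschitz_within setT (fun y => e * mdist x y).
Proof.
exists `|e| => y z _ _; rewrite -mulrBr normrM; apply: ler_wpM2l => //.
have := metric_triangle x y z; have := metric_triangle x z y.
by rewrite (metric_sym z y) ler_norml => ? ?; apply/andP; split; lra.
Qed.

(** The sup norm dominates each coordinate, so a linear form on ['rV_n] is
    Lipschitz with the sum of its coefficients as constant. *)
Lemma lipschitz_rV_dot n (phi : X -> 'rV[R]_n) (L : 'rV[R]_n) A x :
  lipschitz_within A phi ->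
  lipschitz_within A (fun y => \sum_(i < n) L 0 i * (phi y - phi x) 0 i).
Proof.
move=> [K phiK]; exists ((\sum_(i < n) `|L 0 i|) * K) => y z Ay Az.
rewrite -sumrB -mulrA mulr_suml (le_trans (ler_norm_sum _ _ _))//.
apply: ler_sum => i _; rewrite -mulrBr normrM ler_wpM2l//.
apply: le_trans (phiK y z Ay Az).
have -> : (phi y - phi x) 0 i - (phi z - phi x) 0 i = (phi y - phi z) 0 i.
  by rewrite !mxE; lra.
rewrite [leRHS]mx_normrE.
exact: (le_bigmax 0 (fun ij => `|(phi y - phi z) ij.1 ij.2|) (0, i)).
Qed.

End lipschitz_facts.

Section measurable_sublevels.
Context {R : realType} {X : metricType R}.
Context (mu : {outer_measure set X -> \bar R}).
Hypothesis mu_borel : forall B : set X, <<s open >> B -> mu.-caratheodory B.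

Lemma caratheodory_open (A : set X) : open A -> mu.-caratheodory A.
Proof. by move=> oA; apply: mu_borel; exact: sub_sigma_algebra. Qed.

Lemma caratheodory_closed (A : set X) : closed A -> mu.-caratheodory A.
Proof.
move=> cA; rewrite -(setCK A); apply: caratheodory_measurable_setC.
by apply: caratheodory_open; rewrite openC.
Qed.

Context (E : set X) (f : X -> R) (mf : mu_measurable_fun mu E f).

Lemma caratheodory_domain : mu.-caratheodory E.
Proof. by have := mf openT; rewrite preimage_setT setIT. Qed.

(** The inequality [f < q] is witnessed by a rational number between the two
    values. *)
Lemma caratheodory_lt (q : X -> R) : lipschitz_within setT q ->
  mu.-caratheodory (E `&` [set y | f y < q y]).
Proof.
move=> lq.
have -> : E `&` [set y | f y < q y] = \bigcup_(s : rat)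
    (E `&` f @^-1` [set t | t < ratr s] `&` [set y | ratr s < q y]).
  apply/seteqP; split => [y [Ey /= fq]|y [s _ [[Ey /= fs] sq]]].
    have [s] := rat_in_itvoo fq; rewrite in_itv /= => /andP[fs sq].
    by exists s.
  by split=> //=; exact: lt_trans sq.
rewrite bigcup_unpickle; apply: caratheodory_measurable_bigcup => n.
case: unpickle => [s|] /=; last exact: caratheodory_measurable_set0.
apply: caratheodory_measurable_setI; first by apply: mf; exact: open_lt.
by apply: caratheodory_open; exact: lipschitz_open_gt.
Qed.

Lemma caratheodory_gt (q : X -> R) : lipschitz_within setT q ->
  mu.-caratheodory (E `&` [set y | q y < f y]).
Proof.
move=> lq.
have -> : E `&` [set y | q y < f y] = \bigcup_(s : rat)
    (E `&` f @^-1` [set t | ratr s < t] `&` [set y | q y < ratr s]).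
  apply/seteqP; split => [y [Ey /= fq]|y [s _ [[Ey /= fs] sq]]].
    have [s] := rat_in_itvoo fq; rewrite in_itv /= => /andP[fs sq].
    by exists s.
  by split=> //=; exact: lt_trans fs.
rewrite bigcup_unpickle; apply: caratheodory_measurable_bigcup => n.
case: unpickle => [s|] /=; last exact: caratheodory_measurable_set0.
apply: caratheodory_measurable_setI; first by apply: mf; exact: open_gt.
by apply: caratheodory_open; exact: lipschitz_open_lt.
Qed.

Lemma caratheodory_eq (q : X -> R) : lipschitz_within setT q ->
  mu.-caratheodory (E `&` [set y | f y = q y]).
Proof.
move=> lq.
have -> : E `&` [set y | f y = q y] =
    E `\` (E `&` [set y | f y < q y]) `\` (E `&` [set y | q y < f y]).
  apply/seteqP; split => [y [Ey /= fq]|y [[Ey fq] qf]].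
    by split; [split => //|]; move=> -[_] /=; rewrite fq ltxx.
  split => //=; apply/eqP; rewrite eq_le !leNgt.
  by apply/andP; split; apply/negP => ?; [apply: qf|apply: fq].
apply: caratheodory_measurable_setD; last exact: caratheodory_gt.
apply: caratheodory_measurable_setD; last exact: caratheodory_lt.
exact: caratheodory_domain.
Qed.

(** The approximate limit of difference quotients only involves measurable
    sets. Since [x] itself always lies in the set below, it can be written with
    the product [e * mdist x y] in place of the quotient. *)
Lemma caratheodory_quotient_lt n (phi : X -> 'rV[R]_n) (L : 'rV[R]_n) x e :
    E x -> 0 < e -> lipschitz_within setT phi ->
  mu.-caratheodory [set y | E y /\ `| `|f y - f x -
    \sum_(i < n) L 0 i * (phi y - phi x) 0 i| / mdist x y - 0| < e].
Proof.
move=> Ex e0 lphi.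
pose p y := f x + \sum_(i < n) L 0 i * (phi y - phi x) 0 i.
have lp : lipschitz_within setT p.
  apply: lipschitzD; last exact: lipschitz_rV_dot.
  by exists 0 => y z _ _; rewrite subrr normr0 mul0r.
rewrite (_ : [set _ | _] = [set x] `|`
  (E `&` [set y | f y < p y + e * mdist x y]) `&`
  (E `&` [set y | p y - e * mdist x y < f y])).
  apply: caratheodory_measurable_setU.
    apply: caratheodory_closed; apply: accessible_closed_set1.
    exact: (hausdorff_accessible (@metric_hausdorff _ X)).
  apply: caratheodory_measurable_setI.
    by apply: caratheodory_lt; apply: lipschitzD => //; exact: lipschitz_mdist.
  apply: caratheodory_gt; apply: lipschitzD => //; apply: lipschitzN.
  exact: lipschitz_mdist.
apply/seteqP; split => y /=.
  move=> [Ey]; have [->|yx] := eqVneq y x; first by left.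
  rewrite subr0 ger0_norm; last by rewrite divr_ge0// mdist_ge0.
  rewrite ltr_pdivrMr; last by rewrite mdist_gt0 eq_sym.
  rewrite ltr_norml => /andP[lo hi]; right.
  by rewrite /p; split; split => //=; lra.
have [-> _|yx [/eqP|[[Ey hi] [_ lo]]]] := eqVneq y x.
- by split => //; rewrite mdistxx invr0 mulr0 subr0 normr0.
- by rewrite (negbTE yx).
- split => //; rewrite subr0 ger0_norm; last by rewrite divr_ge0// mdist_ge0.
  rewrite ltr_pdivrMr; last by rewrite mdist_gt0 eq_sym.
  by move: hi lo; rewrite /= /p ltr_norml => hi lo; apply/andP; split; lra.
Qed.

End measurable_sublevels.

(** * Doubling measures: size of balls and regularity *)

Section doubling_measure.
Context {R : realType} {X : metricType R}.
Context (mu : {outer_measure set X -> \bar R}).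
Hypothesis mu_mms : metric_measure_space mu.
Hypothesis mu_doubling : doubling mu.
Implicit Types (A P S U : set X) (x y : X) (r : R).

Let mu_borel : forall B : set X, <<s open >> B -> mu.-caratheodory B.
Proof. by case: (mms_borel_regular mu_mms). Qed.

Lemma mms_inhabited : exists x : X, True.
Proof.
apply: contrapT => noX; have := mms_nontrivial mu_mms.
rewrite (_ : setT = set0) ?outer_measure0 ?ltxx//.
by apply/seteqP; split => // x _; apply: noX; exists x.
Qed.

Lemma bounded_exhaustion x y : exists n, ball x n.+1%:R y.
Proof.
exists (Num.truncn (mdist x y)).
by rewrite in_ballE; apply: truncnS_gt.
Qed.

Lemma pow2_dominates r0 r : 0 < r0 -> exists k, r < 2 ^+ k * r0.
Proof.
move=> r00; exists (Num.truncn (r / r0)).+1.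
rewrite -ltr_pdivrMr//; apply: lt_trans (truncnS_gt (r / r0)) _.
by rewrite -natrX ltr_nat ltn_expl.
Qed.

Lemma doubling_iter : exists2 C : R, 0 < C & forall k x r, 0 < r ->
  (mu (ball x (2 ^+ k * r)) <= (C ^+ k)%:E * mu (ball x r))%E.
Proof.
have [C C0 muC] := mu_doubling; exists C => // k x r r0.
elim: k => [|k IH]; first by rewrite !expr0 mul1r mul1e.
rewrite !exprS -mulrA; apply: le_trans (muC x _ _) _.
  by rewrite mulr_gt0// exprn_gt0.
by rewrite EFinM -muleA; apply: lee_wpmul2l => //; rewrite lee_fin ltW.
Qed.

(** Doubling spreads the finiteness of the measure of one small ball to all the
    concentric ones; in the same way a null ball would make the whole space
    null. *)
Lemma ball_fin x r : (mu (ball x r) < +oo)%E.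
Proof.
have [C C0 muC] := doubling_iter.
have [r0 r00 fin] := mms_locally_finite mu_mms x.
have [k rk] := pow2_dominates r r00.
apply: (@le_lt_trans _ _ (mu (ball x (2 ^+ k * r0)))).
  by apply: le_outer_measure; apply: le_ball; exact: ltW.
apply: le_lt_trans (muC k x r0 r00) _.
by rewrite lte_mul_pinfty ?lee_fin ?exprn_ge0// ltW.
Qed.

Lemma ball_gt0 x r : 0 < r -> (0 < mu (ball x r))%E.
Proof.
move=> r0; rewrite lt_neqAle outer_measure_ge0 andbT eq_sym.
apply/eqP => mu0; have [C C0 muC] := doubling_iter.
suff : mu setT = 0%E by have := mms_nontrivial mu_mms => /[swap] ->; rewrite ltxx.
have -> : setT = \bigcup_k ball x (2 ^+ k * r).
  apply/seteqP; split => // y _; have [k yk] := pow2_dominates (mdist x y) r0.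
  by exists k => //; rewrite in_ballE.
apply: bigcup_null => k; apply/eqP; rewrite eq_le outer_measure_ge0 andbT.
by apply: le_trans (muC k x r r0) _; rewrite mu0 mule0.
Qed.

Lemma ball_finE x r : mu (ball x r) = (fine (mu (ball x r)))%:E.
Proof. by rewrite fineK// ge0_fin_numE ?outer_measure_ge0// ball_fin. Qed.

Let approximable (O S : set X) := forall e : R, 0 < e -> exists U K,
  [/\ open U, closed K, K `<=` S, S `<=` U & (mu (O `&` (U `\` K)) < e%:E)%E].

(** The sets that can be squeezed between a closed and an open set form a
    sigma-algebra, and an open set is a countable union of closed ones. *)
Lemma borel_approximable (O S : set X) : (mu O < +oo)%E -> <<s open >> S ->
  approximable O S.
Proof.
move=> Ooo; have finO S' : (mu (O `&` S') < +oo)%E.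
  by apply: le_lt_trans Ooo; apply: le_outer_measure => x [].
move: S; apply: (smallest_sub (C := sigma_algebra setT)) => [|S oS e e0]; last first.
  have [K cK KS] := open_bigcup_closed oS.
  have [|N tailN] := caratheodory_tail (A := K) (X := O) _ (finO _) e0.
    by move=> n; exact: caratheodory_closed.
  exists S, (\bigcup_(k < N) K k); split => //.
  - by apply: closed_bigcup => //; exact: finite_II.
  - by rewrite -KS; apply: bigcup_sub => k _; exact: bigcup_sup.
  - by rewrite -{1}KS.
split.
- move=> e e0; exists set0, set0; split => //; [exact: open0|exact: closed0|].
  by rewrite set0D setI0 outer_measure0 lte_fin.
- move=> S appS e e0; have [U [K [oU cK KS SU UK]]] := appS e e0.
  exists (~` K), (~` U); split; rewrite ?openC ?closedC//.
  + by move=> x nUx; split => // /SU.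
  + by move=> x [_ nSx] /KS.
  + by rewrite (_ : ~` K `\` ~` U = U `\` K)// setDE setCK setIC -setDE.
- move=> S appS e e0.
  have e20 : 0 < e / 2 by rewrite divr_gt0.
  have /choice[U /choice[K UK]] n : exists U K, [/\ open U, closed K, K `<=` S n,
      S n `<=` U & (mu (O `&` (U `\` K)) < (e / 2 / (2 ^ n.+1)%:R)%:E)%E].
    by apply: appS; rewrite divr_gt0// ltr0n expn_gt0.
  have [|N tailN] := caratheodory_tail (A := K) (X := O) _ (finO _) e20.
    by move=> n; apply: caratheodory_closed; case: (UK n).
  exists (\bigcup_n U n), (\bigcup_(n < N) K n); split.
  + by apply: bigcup_open => n _; case: (UK n).
  + by apply: closed_bigcup => [|n _]; [exact: finite_II|case: (UK n)].
  + by apply: bigcup_sub => n _ x; case: (UK n) => _ _ KS _ _ /KS; exists n.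
  + by apply: subset_bigcup => n _; case: (UK n).
  + have sub : O `&` (\bigcup_n U n `\` \bigcup_(n < N) K n) `<=`
        \bigcup_n (O `&` (U n `\` K n)) `|`
        O `&` (\bigcup_n K n `\` \bigcup_(n < N) K n).
      move=> x [Ox [[n _ Unx] nK]].
      have [Knx|nKnx] := pselect (K n x); last by left; exists n.
      by right; split => //; split => //; exists n.
    apply: le_lt_trans (le_outer_measure mu _ _ sub) _.
    apply: le_lt_trans (outer_measureU2 _ _ _) _.
    have le2 : (mu (\bigcup_n (O `&` (U n `\` K n))) <= (e / 2)%:E)%E.
      apply: bigcup_le_eps => [|n]; first exact: ltW.
      by apply: ltW; case: (UK n).
    rewrite (splitr e) EFinD; apply: lee_ltD => //.
    rewrite ge0_fin_numE ?outer_measure_ge0//.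
    exact: le_lt_trans le2 (ltry _).
Qed.

(** Within each ball of an exhaustion, a measurable set has a Borel hull of the
    same finite measure, hence differing from it by a null set; the hull is
    approximated from outside by an open set. *)
Lemma caratheodory_outer_regular A (e : R) : mu.-caratheodory A -> 0 < e ->
  exists U, [/\ open U, A `<=` U & (mu (U `\` A) < e%:E)%E].
Proof.
move=> mA e0; have [x0 _] := mms_inhabited.
have e20 : 0 < e / 2 by rewrite divr_gt0.
pose O n := ball x0 n.+1%:R.
have local n : exists U, [/\ open U, A `&` O n `<=` U &
    (mu (U `\` A) <= (e / 2 / (2 ^ n.+1)%:R)%:E)%E].
  have mAO : mu.-caratheodory (A `&` O n).
    apply: caratheodory_measurable_setI => //; apply: caratheodory_open => //.
    exact: open_ball_mdist.
  have AOfin : mu (A `&` O n) \is a fin_num.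
    rewrite ge0_fin_numE ?outer_measure_ge0//; apply: le_lt_trans (ball_fin x0 n.+1%:R).
    by apply: le_outer_measure => x [].
  have [B [bB AB muB]] := (mms_borel_regular mu_mms).2 (A `&` O n).
  have BA0 : mu (B `\` (A `&` O n)) = 0%E.
    have := mAO B; rewrite (setIidr AB) muB -setDE addeC => AB0.
    by rewrite -(addeK (mu (B `\` (A `&` O n))) AOfin) -AB0 subee.
  have en0 : 0 < e / 2 / (2 ^ n.+1)%:R by rewrite divr_gt0// ltr0n expn_gt0.
  have [U [K [oU cK KB BU UK]]] := borel_approximable (ball_fin x0 n.+1%:R) bB en0.
  exists (U `&` O n); split.
  - by apply: openI => //; exact: open_ball_mdist.
  - by move=> x AOx; split; [apply: BU; exact: AB|case: AOx].
  - have sub : U `&` O n `\` A `<=`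
        O n `&` (U `\` K) `|` B `\` (A `&` O n).
      move=> x [[Ux Ox] nAx]; have [Kx|nKx] := pselect (K x); last by left.
      by right; split; [exact: KB|move=> -[]].
    apply: le_trans (le_outer_measure mu _ _ sub) _.
    by apply: le_trans (outer_measureU2 _ _ _) _; rewrite BA0 adde0 ltW.
have /choice[U Un] := local.
exists (\bigcup_n U n); split.
- by apply: bigcup_open => n _; case: (Un n).
- move=> x Ax; have [n xn] := bounded_exhaustion x0 x.
  by exists n => //; case: (Un n) => _ AU _; apply: AU.
- apply: (@le_lt_trans _ _ (e / 2)%:E); last by rewrite lte_fin; lra.
  rewrite setD_bigcupl; apply: bigcup_le_eps => [|n]; first exact: ltW.
  by case: (Un n).
Qed.

Lemma caratheodory_inner_regular A (e : R) : mu.-caratheodory A -> 0 < e ->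
  exists K, [/\ closed K, K `<=` A & (mu (A `\` K) < e%:E)%E].
Proof.
move=> /caratheodory_measurable_setC mA e0.
have [U [oU AU UA]] := caratheodory_outer_regular mA e0.
exists (~` U); split; [by rewrite closedC| |].
  by rewrite -[X in _ `<=` X]setCK; exact: subsetC.
by move: UA; rewrite !setDE !setCK setIC.
Qed.

End doubling_measure.

(** * The Lebesgue density theorem *)

Section lebesgue_density.
Context {R : realType} {X : metricType R}.
Context (mu : {outer_measure set X -> \bar R}).
Hypothesis mu_mms : metric_measure_space mu.
Hypothesis mu_doubling : doubling mu.
Implicit Types (A P S U : set X) (x y : X) (r M : R).

Let mu_borel : forall B : set X, <<s open >> B -> mu.-caratheodory B.
Proof. by case: (mms_borel_regular mu_mms). Qed.

Let mu_ball x r : mu.-caratheodory (ball x r).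
Proof. by apply: caratheodory_open => //; exact: open_ball_mdist. Qed.

(** The limit of quotients in [density_point] is replaced by an inequality
    between measures that bears on the complement of [A], to which
    subadditivity and monotonicity apply. *)
Lemma density_pointP A x : mu.-caratheodory A ->
  density_point mu A x <-> forall M, 0 < M -> exists2 d, 0 < d &
    forall r, 0 < r -> r < d -> (M%:E * mu (ball x r `\` A) <= mu (ball x r))%E.
Proof.
move=> mA.
have finB S r : mu (ball x r `&` S) = (fine (mu (ball x r `&` S)))%:E.
  rewrite fineK// ge0_fin_numE ?outer_measure_ge0//.
  apply: le_lt_trans (ball_fin mu_mms mu_doubling x r).
  by apply: le_outer_measure => y [].
pose b r := fine (mu (ball x r)).
pose s r := fine (mu (ball x r `\` A)).
have bE r : mu (ball x r) = (b r)%:E by exact: ball_finE.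
have sE r : mu (ball x r `\` A) = (s r)%:E by rewrite setDE finB -setDE.
have b0 r : 0 < r -> 0 < b r.
  by move=> r0; rewrite -lte_fin -bE ball_gt0.
have quotE r : 0 < r ->
    (mu (ball x r `&` A) / mu (ball x r))%E = (1 - s r / b r)%:E.
  move=> r0; have := mA (ball x r); rewrite -setDE sE bE finB -EFinD.
  move=> -[bts]; rewrite inver gt_eqF ?b0// -EFinM; congr EFin.
  rewrite -[fine _](addrK (s r)) -bts mulrBl divff//.
  by rewrite gt_eqF// b0.
split.
  move=> [_ /fine_cvgP[_ /cvgrPdist_lt cvg1]] M M0.
  have /cvg1 : 0 < M^-1 by rewrite invr_gt0.
  move=> /nbhs_ballP[d /= d0 dM]; exists d => // r r0 rd.
  have := dM r; rewrite /ball /= sub0r normrN gtr0_norm// => /(_ rd r0).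
  rewrite quotE//= opprB addrC subrK => /(le_lt_trans (ler_norm _)).
  rewrite ltr_pdivrMr ?b0// mulrC ltr_pdivlMr// mulrC => sb.
  by rewrite sE bE -EFinM lee_fin ltW.
move=> dens; split => //; apply: cvg_EFin.
  by near=> r; rewrite quotE.
apply/cvgrPdist_lt => e e0.
have [|d d0 dM] := dens (2 / e); first by rewrite divr_gt0.
apply/nbhs_ballP; exists d => //= r.
rewrite /ball /= sub0r normrN => rd r0; rewrite gtr0_norm// in rd.
rewrite quotE//= opprB addrC subrK.
have := dM r r0 rd; rewrite sE bE -EFinM lee_fin => sb.
have s0 : 0 <= s r by rewrite fine_ge0 ?outer_measure_ge0.
have br0 := b0 r r0; rewrite ger0_norm; last by rewrite divr_ge0// ltW.
rewrite ltr_pdivrMr//.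
move: sb; rewrite mulrAC ler_pdivrMr// mulrC; nra.
Unshelve. all: by end_near.
Qed.

(** The weak-type estimate behind the density theorem: the balls that witness
    the failure of density lie in an open set [U] around [A]; the disjoint
    ones among them have total mass at most [M * mu (U `\` A)], which outer
    regularity makes arbitrarily small. *)
Lemma nondensity_null A P x0 r0 M : mu.-caratheodory A -> 0 < M ->
    P `<=` A -> P `<=` ball x0 r0 ->
    (forall x, P x -> forall d, 0 < d -> exists r, [/\ 0 < r, r < d &
      (mu (ball x r) <= M%:E * mu (ball x r `\` A))%E]) ->
  mu P = 0%E.
Proof.
move=> mA M0 PA Pball bad.
have [->|/set0P Pn0] := eqVneq P set0; first exact: outer_measure0.
apply/eqP; rewrite eq_le outer_measure_ge0 andbT; apply/lee_addgt0Pr => e e0.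
rewrite add0e; have [C C0 muC] := doubling_iter mu_doubling.
have e20 : 0 < e / 2 by rewrite divr_gt0.
have C2M : 0 < C ^+ 2 * M by rewrite mulr_gt0// exprn_gt0.
(* [C ^+ 2] pays for tripling the radii and [M] for passing from a ball to the
   part of it outside [A]; the other half of [e] is left for the tail of the
   countable cover. *)
have [|U [oU AU UA]] :=
  caratheodory_outer_regular (e := e / 2 / (C ^+ 2 * M)) mu_mms mu_doubling mA.
  by rewrite divr_gt0.
have /choice[r rP] x : exists r, 0 < r /\ (P x ->
    ball x r `<=` U `&` ball x0 r0 /\
    (mu (ball x r) <= M%:E * mu (ball x r `\` A))%E).
  have [Px|nPx] := pselect (P x); last by exists 1; split.
  have /nbhs_ballP[d /= d0 dU] : nbhs x (U `&` ball x0 r0).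
    apply: open_nbhs_nbhs; split; first by apply: openI => //; exact: open_ball_mdist.
    by split; [exact/AU/PA|exact: Pball].
  have [r' [r'0 r'd bad']] := bad x Px d d0.
  exists r'; split => // _; split => //.
  by apply: subset_trans dU; apply: le_ball; exact: ltW.
have r_gt0 x : 0 < r x by case: (rP x).
have [|c Pc cover] := separable_countable_subcover (U := fun x => ball x (r x))
    (mms_separable mu_mms) Pn0.
  by move=> x _; exact: nbhsx_ballx.
pose B n := ball (c n) (r (c n)).
have BU n : B n `<=` U `&` ball x0 r0 by case: (rP (c n)) => _ /(_ (Pc n))[].
have [||N tailN] := @caratheodory_tail _ _ mu B setT _ _ _ e20.
- by move=> n; exact: mu_ball.
- apply: le_lt_trans (ball_fin mu_mms mu_doubling x0 r0).
  apply: le_outer_measure; rewrite setTI; apply: bigcup_sub => n _.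
  by apply: subset_trans (BU n) _ => x [].
have [D [uD _ tD sD]] := finite_vitali c (iota 0 N) (fun n => r_gt0 (c n)).
have sub : P `<=` setT `&` (\bigcup_n B n `\` \bigcup_(n < N) B n) `|`
    \bigcup_(n in [set` D]) ball (c n) (3 * r (c n)).
  move=> x Px; have Bx := cover x Px.
  have [[n /= nN Bnx]|nBx] := pselect ((\bigcup_(n < N) B n) x); last by left.
  right; have [|j jD] := sD n; first by rewrite mem_iota add0n.
  by move=> sub; exists j => //; exact: sub.
apply: le_trans (le_outer_measure mu _ _ sub) _.
apply: le_trans (outer_measureU2 _ _ _) _.
rewrite (splitr e) EFinD; apply: leeD; first exact: ltW.
apply: le_trans (bigcup_seq_le _ _ _) _.
have ball3 n : (mu (ball (c n) (3 * r (c n))) <=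
    (C ^+ 2 * M)%:E * mu ((U `\` A) `&` B n))%E.
  apply: (@le_trans _ _ (mu (ball (c n) (2 ^+ 2 * r (c n))))).
    apply: le_outer_measure; apply: le_ball.
    by have := r_gt0 (c n); lra.
  apply: le_trans (muC 2%N (c n) _ (r_gt0 _)) _.
  rewrite (EFinM (C ^+ 2)) -muleA; apply: lee_wpmul2l; first by rewrite lee_fin exprn_ge0// ltW.
  case: (rP (c n)) => _ /(_ (Pc n))[_ /le_trans]; apply.
  apply: lee_wpmul2l; first by rewrite lee_fin ltW.
  apply: le_outer_measure => x [Bx nAx]; split; last exact: Bx.
  by split => //; have [] := BU n x Bx.
apply: le_trans (lee_sum _ (fun n _ => ball3 n)) _.
rewrite -ge0_sume_distrr; last by move=> n _; exact: outer_measure_ge0.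
apply: (@le_trans _ _ ((C ^+ 2 * M)%:E * mu (U `\` A))%E).
  apply: lee_wpmul2l; first by rewrite lee_fin ltW.
  by apply: sum_caratheodory_le => // n; exact: mu_ball.
rewrite muleC -lee_pdivlMr//; exact: ltW.
Qed.

Lemma ae_density_point A : mu.-caratheodory A ->
  ae_in mu A (density_point mu A).
Proof.
move=> mA; have [x0 _] := mms_inhabited mu_mms.
pose P n m := A `&` ball x0 n.+1%:R `&` [set x | forall d, 0 < d ->
  exists r, [/\ 0 < r, r < d &
    (mu (ball x r) <= m.+1%:R%:E * mu (ball x r `\` A))%E]].
apply: (@null_subset _ _ _ _ (\bigcup_n \bigcup_m P n m)); last first.
  apply: bigcup_null => n; apply: bigcup_null => m.
  apply: (@nondensity_null A (P n m) x0 n.+1%:R m.+1%:R) => //.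
  - by move=> x [[]].
  - by move=> x [[]].
  - by move=> x [].
move=> x [Ax /= ndens].
have [n xn] := bounded_exhaustion x0 x; exists n => //.
apply: contrapT => nP; apply: ndens; apply/density_pointP => // M M0.
apply: contrapT => nd; apply: nP; exists (Num.truncn M) => //; split => // d d0.
apply: contrapT => nr; apply: nd; exists d => // r r0 rd.
apply: contrapT => nle; apply: nr; exists r; split => //.
move/negP: nle; rewrite -ltNge => /ltW/le_trans; apply.
apply: lee_wpmul2r; first exact: outer_measure_ge0.
by rewrite lee_fin ltW// truncnS_gt.
Qed.

End lebesgue_density.

(** * Luzin decompositions and closed sets *)

Section luzin.
Context {R : realType} {X : metricType R}.
Context (mu : {outer_measure set X -> \bar R}).
Hypothesis mu_mms : metric_measure_space mu.
Hypothesis mu_doubling : doubling mu.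
Context (E : set X) (f : X -> R) (mf : mu_measurable_fun mu E f).
Implicit Types (A B S : set X) (x y z : X).

Let mu_borel : forall B : set X, <<s open >> B -> mu.-caratheodory B.
Proof. by case: (mms_borel_regular mu_mms). Qed.

(** A Luzin decomposition of [A] whose pieces need not be measurable nor stay
    in [A]. Dropping measurability makes the notion easy to glue, and
    [luzin_decomposition_coverable] recovers it at the end. *)
Definition lipschitz_coverable A := exists2 G : nat -> set X,
  (forall j, G j `<=` E /\ lipschitz_within (G j) f) &
  mu (A `\` \bigcup_j G j) = 0%E.

Lemma lipschitz_coverable_ae A B :
  mu (B `\` A) = 0%E -> lipschitz_coverable A -> lipschitz_coverable B.
Proof.
move=> BA [G GE AG]; exists G => //.
apply: (@null_subset _ _ _ _ (A `\` \bigcup_j G j `|` B `\` A)).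
  move=> x [Bx nGx]; have [Ax|nAx] := pselect (A x); [by left|by right].
apply/eqP; rewrite eq_le outer_measure_ge0 andbT.
by apply: le_trans (outer_measureU2 _ _ _) _; rewrite AG BA adde0.
Qed.

Lemma lipschitz_coverableS A B :
  B `<=` A -> lipschitz_coverable A -> lipschitz_coverable B.
Proof.
move=> BA; apply: lipschitz_coverable_ae.
by rewrite (_ : B `\` A = set0) ?outer_measure0//; rewrite setD_eq0.
Qed.

Lemma lipschitz_within_coverable A :
  A `<=` E -> lipschitz_within A f -> lipschitz_coverable A.
Proof.
move=> AE lA; exists (fun=> A) => //.
rewrite (_ : _ `\` _ = set0) ?outer_measure0//.
by rewrite setD_eq0 => x Ax; exists 0%N.
Qed.

Lemma lipschitz_coverable_bigcup (A : (set X)^nat) :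
  (forall n, lipschitz_coverable (A n)) -> lipschitz_coverable (\bigcup_n A n).
Proof.
move=> covA; have /choice[G GP] n : exists G : nat -> set X,
    (forall j, G j `<=` E /\ lipschitz_within (G j) f) /\
    mu (A n `\` \bigcup_j G j) = 0%E.
  by have [G ? ?] := covA n; exists G.
exists (fun k => oapp (fun p : nat * nat => G p.1 p.2) set0 (unpickle k)).
  move=> k; case: unpickle => [[n j]|] /=; first by case: (GP n).
  by split=> //; exists 0 => x y [].
rewrite -bigcup_unpickle.
apply: (@null_subset _ _ _ _ (\bigcup_n (A n `\` \bigcup_j G n j))).
  move=> x [[n _ Anx] nGx]; exists n => //; split => // -[j _ Gx].
  by apply: nGx; exists (n, j).
by apply: bigcup_null => n; case: (GP n).
Qed.

Lemma lipschitz_coverable_local A :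
  (forall x, A x -> exists2 U, nbhs x U & lipschitz_coverable (A `&` U)) ->
  lipschitz_coverable A.
Proof.
move=> locA; have [->|/set0P An0] := eqVneq A set0.
  by apply: lipschitz_within_coverable => //; exists 0 => x y [].
have /choice[U UP] x : exists U, A x -> nbhs x U /\ lipschitz_coverable (A `&` U).
  have [Ax|nAx] := pselect (A x); last by exists set0.
  by have [U ? ?] := locA x Ax; exists U.
have [|c cA covA] := separable_countable_subcover (U := U)
    (mms_separable mu_mms) An0.
  by move=> x /UP[].
apply: lipschitz_coverableS (lipschitz_coverable_bigcup
  (A := fun n => A `&` U (c n)) _).
  by move=> x Ax; have [n _ Ux] := covA x Ax; exists n.
by move=> n; case: (UP (c n) (cA n)).
Qed.

(** McShane's extension makes the pieces measurable: a piece [G] may be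
    enlarged to the set where [f] agrees with the extension of its restriction
    to [G]. *)
Lemma luzin_decomposition_coverable :
  lipschitz_coverable E -> luzin_decomposition mu E f.
Proof.
move=> [G GP EG]; have /choice[g gP] j : exists g : X -> R,
    lipschitz_within setT g /\ forall x, G j x -> g x = f x.
  by have [_ /mcshane[g ? ?]] := GP j; exists g.
exists (fun j => E `&` [set x | f x = g j x]), (E `\` \bigcup_j G j).
split => //.
- apply/seteqP; split => [x Ex|x [[j _ []//]|[]//]].
  have [[j _ Gx]|nGx] := pselect ((\bigcup_j G j) x); last by right.
  by left; exists j => //; split => //=; have [_ ->] := gP j.
- by move=> j; apply: caratheodory_eq => //; case: (gP j).
- move=> j; apply: (@eq_lipschitz_within _ _ _ _ (g j)); first by move=> x [].
  by apply: (@lipschitz_withinS _ _ _ _ setT) => //; case: (gP j).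
Qed.

Lemma coverable_of_closed : (forall e : R, 0 < e -> exists F : set X,
    [/\ closed F, F `<=` E, (mu (E `\` F) < e%:E)%E &
        locally_lipschitz_within F f]) -> lipschitz_coverable E.
Proof.
move=> closedE; have /choice[F FP] n : exists F : set X, [/\ closed F, F `<=` E,
    (mu (E `\` F) < n.+1%:R^-1%:E)%E & locally_lipschitz_within F f].
  by apply: closedE; rewrite invr_gt0.
apply: (@lipschitz_coverable_ae (\bigcup_n F n)).
  apply/eqP; rewrite eq_le outer_measure_ge0 andbT.
  apply/lee_addgt0Pr => e e0; rewrite add0e; have [n ne] := inv_succ_lt e0.
  apply: (@le_trans _ _ (mu (E `\` F n))).
    by apply: le_outer_measure => x [Ex nFx]; split => // Fx; apply: nFx; exists n.
  by case: (FP n) => _ _ /ltW/le_trans + _; apply; rewrite lee_fin ltW.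
apply: lipschitz_coverable_bigcup => n; apply: lipschitz_coverable_local => x Fx.
have [_ FE _ /(_ x Fx)[U xU lU]] := FP n; exists U => //.
by apply: lipschitz_within_coverable => // y [/FE].
Qed.

(** The closed pieces [K j] must form a locally finite family for their union
    to be closed and for [f] to be locally Lipschitz on it: a point then has a
    neighbourhood that meets only the piece to which it belongs. Since balls
    have finite measure, the pieces [G j] of large index occupy little of a
    given ball [O k]. Their traces on [O k] are gathered over all [k] in a set
    [D] of small measure; away from it, only finitely many pieces meet [O k]. *)
Lemma closed_of_luzin : luzin_decomposition mu E f ->
  forall e : R, 0 < e -> exists F : set X, [/\ closed F, F `<=` E,
    (mu (E `\` F) < e%:E)%E & locally_lipschitz_within F f].
Proof.
move=> [G [Z [EGZ mG lG Z0]]] e e0; have [x0 _] := mms_inhabited mu_mms.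
(* One quarter of [e] bounds [D] and another one the closed approximations; the
   rest makes the final inequality strict. *)
pose O k := ball x0 k.+1%:R; pose e' k := e / 4 / (2 ^ k.+1)%:R.
have e'0 k : 0 < e' k by rewrite !divr_gt0// ltr0n expn_gt0.
have mO k : mu.-caratheodory (O k).
  by apply: caratheodory_open => //; exact: open_ball_mdist.
have GE j : G j `<=` E by rewrite EGZ => x Gx; left; exists j.
have /choice[N tailN] k : exists N, (mu (O k `&`
    (\bigcup_j G j `\` \bigcup_(j < N) G j)) < (e' k)%:E)%E.
  apply: caratheodory_tail => //; apply: le_lt_trans (ball_fin mu_mms mu_doubling
    x0 k.+1%:R); by apply: le_outer_measure => x [].
pose D := \bigcup_k (O k `&` (\bigcup_j G j `\` \bigcup_(j < N k) G j)).
have mD : mu.-caratheodory D.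
  apply: caratheodory_measurable_bigcup => k.
  apply: caratheodory_measurable_setI => //; apply: caratheodory_measurable_setD.
    exact: caratheodory_measurable_bigcup.
  by rewrite bigcup_mkord; exact: caratheodory_measurable_bigsetU.
have /choice[K KP] j : exists K, [/\ closed K, K `<=` seqDU G j `\` D &
    (mu (seqDU G j `\` D `\` K) < (e' j)%:E)%E].
  apply: caratheodory_inner_regular => //.
  do 2!apply: caratheodory_measurable_setD => //.
  exact: caratheodory_measurable_bigsetU.
have KG j : K j `<=` G j.
  by have [_ KS _] := KP j; move=> x /KS[Gx _]; exact: (subset_seqDU Gx).
have K_disjoint i j x : K i x -> K j x -> i = j.
  have [_ KSi _] := KP i; have [_ KSj _] := KP j.
  move=> /KSi[Gix _] /KSj[Gjx _].
  by apply: (trivIset_seqDU G) => //; exists x.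
have K_local j k x : K j x -> O k x -> (j < N k)%N.
  move=> Kx Ox; rewrite ltnNge; apply/negP => Nj.
  have [_ /(_ x Kx)[Gx nDx] _] := KP j; apply: nDx; exists k => //; split => //.
  split; first by exists j => //; exact: (subset_seqDU Gx).
  case=> i /= iN Gix; case: Gx => _; apply; rewrite -bigcup_mkord.
  by exists i => //=; exact: leq_trans iN Nj.
have closed_part k (Q : set nat) : closed (\bigcup_(j in `I_(N k) `&` Q) K j).
  apply: closed_bigcup => [|j _]; last by case: (KP j).
  by apply: finite_setIl; exact: finite_II.
exists (\bigcup_j K j); split.
- rewrite -openC openE => x nKx; have [k xk] := bounded_exhaustion x0 x.
  apply: (@filterS _ _ _ (O k `&` ~` \bigcup_(j in `I_(N k) `&` setT) K j)).
    move=> y [Oy nKy] [j _ Kjy]; apply: nKy; exists j => //.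
    by split => //=; exact: K_local Oy.
  apply: open_nbhs_nbhs; split; last by split => // -[j _ Kjx]; apply: nKx; exists j.
  by apply: openI; [exact: open_ball_mdist|rewrite openC; exact: closed_part].
- by apply: bigcup_sub => j _ x /KG; exact: GE.
- have sub : E `\` \bigcup_j K j `<=` Z `|` (D `|` \bigcup_j (seqDU G j `\` D `\` K j)).
    move=> x [+ nKx]; rewrite EGZ => -[Gx|Zx]; last by left.
    have [Dx|nDx] := pselect (D x); first by right; left.
    move: Gx; rewrite seqDU_bigcup_eq => -[j _ Gx]; right; right; exists j => //.
    by split => // Kx; apply: nKx; exists j.
  apply: (@le_lt_trans _ _ ((e / 4)%:E + (e / 4)%:E)%E); last first.
    by rewrite -EFinD lte_fin; lra.
  apply: le_trans (le_outer_measure mu _ _ sub) _.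
  apply: le_trans (outer_measureU2 _ _ _) _; rewrite Z0 add0e.
  have e40 : 0 <= e / 4 by rewrite divr_ge0// ltW.
  apply: le_trans (outer_measureU2 _ _ _) _; apply: leeD.
    by apply: bigcup_le_eps => // k; exact: ltW.
  by apply: bigcup_le_eps => // j; apply: ltW; case: (KP j).
- move=> x [i _ Kix]; have [k xk] := bounded_exhaustion x0 x.
  exists (O k `&` ~` \bigcup_(j in `I_(N k) `&` [set j | j != i]) K j).
    apply: open_nbhs_nbhs; split.
      by apply: openI; [exact: open_ball_mdist|rewrite openC; exact: closed_part].
    by split => // -[j [_ /= /eqP ji] Kjx]; apply: ji; exact: K_disjoint Kjx Kix.
  apply: lipschitz_withinS (lG i) => y [[j _ Kjy] [Oy nKy]].
  have [<-|ji] := eqVneq j i; first exact: KG.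
  by case: nKy; exists j => //; split => //=; exact: K_local Oy.
Qed.

End luzin.

(** * Approximate differentiability *)

Section approximate_differentiability.
Context {R : realType} {X : metricType R}.
Context (mu : {outer_measure set X -> \bar R}).
Hypothesis mu_mms : metric_measure_space mu.
Hypothesis mu_doubling : doubling mu.
Context (E : set X) (f : X -> R) (mf : mu_measurable_fun mu E f).
Implicit Types (A B S : set X) (x y z : X) (K M d : R).

Let mu_borel : forall B : set X, <<s open >> B -> mu.-caratheodory B.
Proof. by case: (mms_borel_regular mu_mms). Qed.

Lemma density_pointI A B S x : mu.-caratheodory S -> A `&` B `<=` S ->
  density_point mu A x -> density_point mu B x -> density_point mu S x.
Proof.
move=> mS ABS dA dB; apply/(density_pointP mu_mms mu_doubling x mS) => M M0.
have M20 : 0 < 2 * M by rewrite mulr_gt0.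
have [d1 d10 A1] := (density_pointP mu_mms mu_doubling x dA.1).1 dA _ M20.
have [d2 d20 B2] := (density_pointP mu_mms mu_doubling x dB.1).1 dB _ M20.
exists (Num.min d1 d2); first by rewrite lt_min d10.
move=> r r0; rewrite lt_min => /andP[rd1 rd2].
have sub : ball x r `\` S `<=` (ball x r `\` A) `|` (ball x r `\` B).
  move=> y [By nSy]; have [Ay|nAy] := pselect (A y); last by left.
  by right; split => // By'; apply/nSy/ABS.
have half : ((2 * M)%:E * mu (ball x r `\` S) <= 2%:E * mu (ball x r))%E.
  apply: (@le_trans _ _ ((2 * M)%:E *
    (mu (ball x r `\` A) + mu (ball x r `\` B)))%E).
    apply: lee_wpmul2l; first by rewrite lee_fin ltW.
    exact: le_trans (le_outer_measure mu _ _ sub) (outer_measureU2 _ _ _).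
  rewrite ge0_muleDr ?outer_measure_ge0//.
  by rewrite mule_natl mule2n; apply: leeD; [exact: A1|exact: B2].
by move: half; rewrite EFinM -muleA lee_pmul2l.
Qed.

Definition cone M x := [set y | E y /\ `|f y - f x| <= M * mdist x y].

(** Density of the cone at [x], with a uniform scale [d]; the complement of the
    cone is weighed by outer measure, for which monotonicity and subadditivity
    are enough. *)
Definition cone_points K M d := [set x | E x /\ forall r, 0 < r -> r < d ->
  (K%:E * mu (ball x r `\` cone M x) <= mu (ball x r))%E].

(** The cones of two nearby points [x] and [y] have a common point [w] with
    [mdist y w < rho] and [mdist x w < 2 * rho], where [rho = mdist x y],
    because doubling compares [ball x (2 * rho)] with [ball y rho]. Going
    through [w] bounds [`|f x - f y|] by [3 * M * rho]. *)
Lemma cone_points_lipschitz : exists2 K, 0 < K & forall M d z, 0 <= M -> 0 < d ->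
  lipschitz_within (cone_points K M d `&` ball z (d / 4)) f.
Proof.
have [C C0 muC] := doubling_iter mu_doubling.
have C20 : 0 < C ^+ 2 by rewrite exprn_gt0.
(* If the two cones were disjoint in [ball y rho], their complements would
   cover it; they have measure at most [C ^+ 2 / K] and [1 / K] times that of
   [ball y rho], so any [K > C ^+ 2 + 1] gives a contradiction. *)
exists (C ^+ 2 + 2) => [|M d z M0 d0]; first exact: addr_gt0.
exists (3 * M) => x y [[Ex Kx] zx] [[Ey Ky] zy].
have [->|xy] := eqVneq x y; first by rewrite subrr normr0 mdistxx mulr0.
set rho := mdist x y; have rho0 : 0 < rho by rewrite mdist_gt0.
(* This is why the radius of the ball around [z] is [d / 4]. *)
have rhod : 2 * rho < d.
  move: zx zy; rewrite !in_ballE; have := metric_triangle x z y.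
  by rewrite (metric_sym x z) -/rho; lra.
have [[w [yw [_ xw] [_ yw']]]|nw] :=
    pselect (exists w, [/\ ball y rho w, cone M x w & cone M y w]).
  move: yw; rewrite in_ballE => yw.
  have xw2 : mdist x w <= 2 * rho.
    by have := metric_triangle x y w; rewrite -/rho; lra.
  have := ler_wpM2l M0 xw2; have := ler_wpM2l M0 (ltW yw).
  have := ler_normD (f x - f w) (f w - f y); rewrite subrKA (distrC (f x) (f w)).
  by move: xw yw' => /=; rewrite -/rho; lra.
have rho20 : 0 < 2 * rho by rewrite mulr_gt0.
have rho_d : rho < d by lra.
have := Ky rho rho0 rho_d; have := Kx (2 * rho) rho20 rhod.
have cover : ball y rho `<=`
    (ball x (2 * rho) `\` cone M x) `|` (ball y rho `\` cone M y).
  move=> w yw; have [Sx|nSx] := pselect (cone M x w).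
    by right; split => // Sy; apply: nw; exists w.
  left; split => //; move: yw; rewrite !in_ballE => yw.
  by have := metric_triangle x y w; rewrite -/rho; lra.
have big_ball : (mu (ball x (2 * rho)) <= (C ^+ 2)%:E * mu (ball y rho))%E.
  apply: le_trans (muC 2%N y rho rho0); apply: le_outer_measure => w.
  rewrite !in_ballE => xw; have := metric_triangle y x w.
  by rewrite (metric_sym y x) -/rho; lra.
move=> /le_trans/(_ big_ball) leKx leKy.
have : ((C ^+ 2 + 2)%:E * mu (ball y rho) <= (C ^+ 2 + 1)%:E * mu (ball y rho))%E.
  rewrite (EFinD (C ^+ 2) 1) ge0_muleDl ?lee_fin ?(ltW C20)// mul1e.
  apply: le_trans _ (leeD leKx leKy); rewrite -ge0_muleDr ?outer_measure_ge0//.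
  apply: lee_wpmul2l; first by rewrite lee_fin ltW// addr_gt0.
  exact: le_trans (le_outer_measure mu _ _ cover) (outer_measureU2 _ _ _).
have := ball_gt0 mu_mms mu_doubling y rho0.
rewrite ball_finE// lte_fin -!EFinM lee_fin => b0.
by rewrite ler_pM2r//; lra.
Qed.

(** The linear part of the approximate Taylor expansion is Lipschitz, say with
    constant [Q], and the remainder is less than [mdist x y] on a set that has
    [x] as a density point; so that set lies in the cone of slope [Q + 1]. *)
Lemma approx_differentiable_cone n (phi : X -> 'rV[R]_n) x K :
    lipschitz_within setT phi -> E x -> approx_differentiable mu E f phi x ->
    0 < K ->
  exists m k, cone_points K k%:R m.+1%:R^-1 x.
Proof.
move=> lphi Ex [L derL] K0.
have dens := derL _ (ltr01 : 0 < 1 :> R).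
have [d d0 densK] := (density_pointP mu_mms mu_doubling x dens.1).1 dens _ K0.
have [m md] := inv_succ_lt d0; have /lipschitz_withinP[Q Q0 lQ] :=
  lipschitz_rV_dot L x lphi.
exists m, (Num.truncn (Q + 1)).+1; split => // r r0 rm.
apply: le_trans (densK r r0 (lt_trans rm md)).
apply: lee_wpmul2l; first by rewrite lee_fin ltW.
apply: le_outer_measure; apply: setDS => y [Ey]; rewrite subr0 => quot.
split => //; have [->|yx] := eqVneq y x.
  by rewrite subrr normr0 mdistxx mulr0.
have xy : 0 < mdist x y by rewrite mdist_gt0 eq_sym.
apply: (@le_trans _ _ ((Q + 1) * mdist x y)); last first.
  by apply: ler_wpM2r; [exact: mdist_ge0|exact/ltW/truncnS_gt].
move: quot; rewrite ger0_norm; last by rewrite divr_ge0// mdist_ge0.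
rewrite ltr_pdivrMr// mul1r => quot.
have := lQ y x Logic.I Logic.I.
rewrite [X in _ - X](big1 _ xpredT); last first.
  by move=> i _; rewrite subrr mxE mulr0.
rewrite subr0 metric_sym => dot.
have := ler_normD (f y - f x - \sum_(i < n) L 0 i * (phi y - phi x) 0 i)
  (\sum_(i < n) L 0 i * (phi y - phi x) 0 i).
by rewrite subrK mulrDl mul1r; lra.
Qed.

Context (I : countType) (Xa : I -> set X) (N : I -> nat)
  (xa : forall a : I, X -> 'rV[R]_(N a)).
Hypothesis structure : approx_diff_structure mu Xa xa.

(** Almost every point of [E] is a cone point for some integral slope and some
    scale [1 / m.+1], and [f] is Lipschitz on small balls of cone points. *)
Lemma coverable_of_approx_differentiable :
  approx_differentiable_ae mu Xa xa E f -> lipschitz_coverable mu E f E.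
Proof.
move=> diff; have [K K0 lipK] := cone_points_lipschitz.
apply: (@lipschitz_coverable_ae _ _ _ _ _
  (\bigcup_m \bigcup_k cone_points K k%:R m.+1%:R^-1)).
  apply: (@null_subset _ _ _ _ (E `&` [set x | ~ (forall a, Xa a x ->
    approx_differentiable mu E f (xa a) x)] `|` ~` \bigcup_a Xa a)).
    move=> x [Ex ncone]; have [[a _ ax]|] := pselect ((\bigcup_a Xa a) x);
      last by right.
    left; split => // diffx; apply: ncone.
    have [m [k xcone]] := approx_differentiable_cone (ads_lipschitz structure a)
      Ex (diffx a ax) K0.
    by exists m => //; exists k.
  apply/eqP; rewrite eq_le outer_measure_ge0 andbT.
  apply: le_trans (outer_measureU2 _ _ _) _.
  by rewrite diff (ads_cover structure) adde0.
do 2!apply: lipschitz_coverable_bigcup => ?.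
apply: lipschitz_coverable_local => // x _.
set d := _^-1; have d0 : 0 < d by rewrite invr_gt0.
exists (ball x (d / 4)); first by apply: nbhsx_ballx; rewrite divr_gt0.
apply: lipschitz_within_coverable; last exact: lipK.
by move=> y [[]].
Qed.

(** The Lipschitz extension of [f] from a piece [G j] has a differential at
    almost every point of the charts, and at a density point of [G j] the
    values of [f] off [G j] do not affect approximate limits. *)
Lemma approx_differentiable_of_luzin :
  luzin_decomposition mu E f -> approx_differentiable_ae mu Xa xa E f.
Proof.
move=> [G [Z [EGZ mG lG Z0]]].
have GE j : G j `<=` E by rewrite EGZ => x Gx; left; exists j.
have /choice[g gP] j : exists g : X -> R,
    lipschitz_within setT g /\ forall x, G j x -> g x = f x.
  by have /mcshane[g ? ?] := lG j; exists g.
pose bad j a := G j `&` Xa a `&`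
  [set x | ~ approx_differentiable mu setT (g j) (xa a) x].
apply: (@null_subset _ _ _ _ (Z `|`
  \bigcup_j (G j `&` [set x | ~ density_point mu (G j) x] `|`
             \bigcup_a bad j a))); last first.
  apply/eqP; rewrite eq_le outer_measure_ge0 andbT.
  apply: le_trans (outer_measureU2 _ _ _) _; rewrite Z0 add0e.
  rewrite bigcup_null// => j; apply/eqP; rewrite eq_le outer_measure_ge0 andbT.
  apply: le_trans (outer_measureU2 _ _ _) _.
  rewrite (ae_density_point mu_mms mu_doubling (mG j)) add0e.
  rewrite bigcup_unpickle bigcup_null// => n.
  case: unpickle => [a|] /=; last exact: outer_measure0.
  have [h [_ _ ae_h] _] := ads_differential structure a (gP j).1.
  apply: null_subset ae_h => x [[_ ax] nx]; split => // hx; apply: nx.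
  by exists (h x).
move=> x [Ex ndiff]; move: (Ex); rewrite EGZ => -[[j _ Gx]|Zx]; last by left.
right; exists j => //; apply: contrapT => good; apply: ndiff => a ax.
have dens : density_point mu (G j) x.
  by apply: contrapT => nd; apply: good; left.
have [L derL] : approx_differentiable mu setT (g j) (xa a) x.
  by apply: contrapT => nd; apply: good; right; exists a.
exists L => e e0; apply: density_pointI (derL e e0) dens.
  by apply: caratheodory_quotient_lt => //; exact: (ads_lipschitz structure).
move=> y [[_ quot] Gy]; split; first exact: GE Gy.
by have [_ gf] := gP j; rewrite /= -(gf y Gy) -(gf x Gx).
Qed.

End approximate_differentiability.

(** * The equivalence *)

Theorem theorem2p1 (R : realType) (X : completeMetricType R)
    (mu : {outer_measure set X -> \bar R})
    (hX : metric_measure_space mu) (hmu : doubling mu)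
    (I : countType) (Xa : I -> set X) (N : I -> nat)
    (xa : forall a : I, X -> 'rV[R]_(N a))
    (hstruct : approx_diff_structure mu Xa xa)
    (E : set X) (f : X -> R) (hf : mu_measurable_fun mu E f) :
  [<-> approx_differentiable_ae mu Xa xa E f;
       forall e : R, 0 < e ->
         exists F : set X,
           [/\ closed F, F `<=` E, (mu (E `\` F) < e%:E)%E &
               locally_lipschitz_within F f];
       luzin_decomposition mu E f].
Proof.
tfae.
- move=> /(coverable_of_approx_differentiable hX hmu hstruct) covE.
  exact/(closed_of_luzin hX hmu)/(luzin_decomposition_coverable hX hf).
- move=> closedE; apply: (luzin_decomposition_coverable hX hf).
  exact: coverable_of_closed.
- exact: approx_differentiable_of_luzin.
Qed.
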